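(* Let $K>1$, $\mathcal{Y}=\{1,\dots,K\}$, $(X,Y,M)$ distributed on $\mathcal{X}\times\mathcal{Y}\times\mathcal{Y}$, and let $\bm{g}:\mathcal{X}\to\mathbb{R}^{K+1}$ be measurable with classifier part $\bm{g}_{\rm class}=(g_1,\dots,g_K)$. Then $$\max\Big(R_{01}(\bm{g}_{\rm class})-R_{01}^*,\ R^{\bot}_{01}(\bm{g})-R^{\bot*}_{01}\Big)\le\sqrt{2\big(R_{L_{\tilde{\psi}}}(\bm{g})-R^*_{L_{\tilde{\psi}}}\big)}.$$
   Context: Asymmetric softmax: $\tilde{\psi}_y(\bm{u})=\exp(u_y)/\sum_{y'=1}^K\exp(u_{y'})$ for $y\le K$, $\tilde{\psi}_{K+1}(\bm{u})=\exp(u_{K+1})/(\sum_{y'=1}^{K+1}\exp(u_{y'})-\max_{y'\le K}\exp(u_{y'}))$. Surrogate $L_{\tilde{\psi}}(\bm{u},y,m)=-\log\tilde{\psi}_y(\bm{u})-[\![m\ne y]\!]\log(1-\tilde{\psi}_{K+1}(\bm{u}))-[\![m=y]\!]\log\tilde{\psi}_{K+1}(\bm{u})$, $R_{L_{\tilde{\psi}}}(\bm{g})=\mathbb{E}[L_{\tilde{\psi}}(\bm{g}(X),Y,M)]$ and $R^*_{L_{\tilde{\psi}}}$ its infimum over measurable $\bm{g}$. $R_{01}(\bm{g}_{\rm class})=\Pr(\mathop{\rm argmax}_{y\le K}g_y(X)\ne Y)$ and $R^*_{01}$ is the Bayes (minimal) misclassification error. The 0-1-deferral loss is $\ell^{\bot}_{01}(f(\bm{x}),y,m)=[\![f(\bm{x})\in\mathcal{Y},\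 f(\bm{x})\ne y]\!]+[\![f(\bm{x})=\bot,\ m\ne y]\!]$; $R^{\bot}_{01}(\bm{g})=\mathbb{E}[\ell^{\bot}_{01}(\varphi(\bm{g}(X)),Y,M)]$ where $\varphi(\bm{u})=\bot$ if $u_{K+1}>\max_{y\le K}u_y$ and $\varphi(\bm{u})=\mathop{\rm argmax}_{y\le K}u_y$ otherwise; $R^{\bot*}_{01}$ is the infimum of the 0-1-deferral risk over all $f:\mathcal{X}\to\mathcal{Y}\cup\{\bot\}$. *)

(* Defs.v *)
From HB Require Import structures.
From mathcomp Require Import all_boot all_order all_algebra.
From mathcomp Require Import all_classical all_reals all_analysis.
Set Implicit Arguments. Unset Strict Implicit. Unset Printing Implicit Defensive.
Import Order.TTheory GRing.Theory Num.Theory.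
Import numFieldNormedType.Exports.
Local Open Scope classical_set_scope.
Local Open Scope ring_scope.

Section Defs.
Context {R : realType}.
Context {K : nat}.

(* Score vectors u in R^{K+1} are functions 'I_K.+1 -> R.
   Class y in {1..K} is the ordinal y : 'I_K, embedded as [cls y];
   the deferral coordinate K+1 is ord_max. *)
Definition cls (y : 'I_K) : 'I_K.+1 := widen_ord (leqnSn K) y.
Definition dfr : 'I_K.+1 := ord_max.

Definition psi_cls (u : 'I_K.+1 -> R) (y : 'I_K) : R :=
  expR (u (cls y)) / \sum_(y' < K) expR (u (cls y')).
Definition psi_dfr (u : 'I_K.+1 -> R) : R :=
  expR (u dfr) / (\sum_(y' < K.+1) expR (u y')
                  - \big[Num.max/0]_(y' < K) expR (u (cls y'))).

Definition Lpsi (u : 'I_K.+1 -> R) (y m : 'I_K) : R :=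
  - ln (psi_cls u y)
  - (m != y)%:R * ln (1 - psi_dfr u)
  - (m == y)%:R * ln (psi_dfr u).

(* argmax over the K classes (ties broken by the first maximiser) *)
Definition argmax_cls (u : 'I_K.+1 -> R) : option 'I_K :=
  [pick i : 'I_K | [forall j : 'I_K, u (cls j) <= u (cls i)]].

(* the induced rule phi: None stands for the deferral option bot *)
Definition phi (u : 'I_K.+1 -> R) : option 'I_K :=
  if ((\big[Order.max/-oo]_(y < K) (u (cls y))%:E) < (u dfr)%:E)%E
  then None else argmax_cls u.

(* 0-1-deferral loss; the prediction f(x) is in option 'I_K, None = bot *)
Definition loss01_defer (fx : option 'I_K) (y m : 'I_K) : R :=
  match fx with
  | Some c => (c != y)%:R
  | None => (m != y)%:R
  end.
End Defs.

Section Risks.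
Local Open Scope ereal_scope.
Context {R : realType} {K : nat}.
Context {d : measure_display} {Omega : measurableType d}
  (P : probability Omega R).
Context {dX : measure_display} {Xs : measurableType dX}.
Variables (X : Omega -> Xs) (Y M : Omega -> 'I_K).

Definition measurable_scorer (g : 'I_K.+1 -> Xs -> R) : Prop :=
  forall i, measurable_fun setT (g i).

Definition measurable_finmap (T : finType) (f : Xs -> T) : Prop :=
  forall t : T, measurable (f @^-1` [set t]).

Definition risk_L (g : 'I_K.+1 -> Xs -> R) : \bar R :=
  \int[P]_w (Lpsi (fun i => g i (X w)) (Y w) (M w))%:E.

Definition risk_L_star : \bar R :=
  ereal_inf [set risk_L g | g in measurable_scorer].

Definition risk01 (g : 'I_K.+1 -> Xs -> R) : \bar R :=
  P [set w | argmax_cls (fun i => g i (X w)) != Some (Y w)].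

Definition risk01_star : \bar R :=
  ereal_inf [set P [set w | h (X w) != Y w] | h in @measurable_finmap _ ].

Definition risk01_defer_of (f : Xs -> option 'I_K) : \bar R :=
  \int[P]_w (loss01_defer (f (X w)) (Y w) (M w))%:E.

Definition risk01_defer (g : 'I_K.+1 -> Xs -> R) : \bar R :=
  risk01_defer_of (fun x => phi (fun i => g i x)).

Definition risk01_defer_star : \bar R :=
  ereal_inf [set risk01_defer_of f | f in @measurable_finmap _].
End Risks.

(* Main.v *)
Require Import Defs.
From mathcomp Require Import all_boot all_order all_algebra.
From mathcomp Require Import all_classical all_reals all_analysis.
From mathcomp Require Import measurable_realfun.
From mathcomp Require Import ring lra.
Set Implicit Arguments.
Unset Strict Implicit.
Unset Printing Implicit Defensive.
Import Order.TTheory GRing.Theory Num.Theory.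
Local Open Scope classical_set_scope.
Local Open Scope ring_scope.

(** The surrogate is the log-loss of a Gibbs distribution on the outcomes
    [(Y, M = Y)], and these outcomes determine whether a decision is correct.
    At every point, the decision [a] induced by [g] is at least as likely to be
    correct under the distribution of [g] as any competing decision [f].  Tilt
    this distribution exponentially, with parameter [lam], towards the outcomes
    where [f] is correct and away from those where [a] is: the log-weight of the
    observed outcome increases by [lam] times the difference of the losses of
    [a] and [f], while by Hoeffding's lemma the log-partition function increases
    by at most [lam ^+ 2 / 2].  As the tilted distribution is again given by a
    measurable scorer, integrating yields
    [R_L^* <= R_L(g) - lam * regret + lam ^+ 2 / 2], and [lam := regret] gives
    the bound.  Neither conditional probabilities nor a minimizer of the
    surrogate risk are needed. *)

Section HyperbolicFunctions.
Context {R : realType}.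
Implicit Types x : R.

Definition cosh x : R := (expR x + expR (- x)) / 2.
Definition sinh x : R := (expR x - expR (- x)) / 2.

#[local] Instance is_derive_cosh x : is_derive x 1 cosh (sinh x).
Proof. by apply: is_derive_eq; rewrite /GRing.scale/= /sinh; field. Qed.

#[local] Instance is_derive_sinh x : is_derive x 1 sinh (cosh x).
Proof. by apply: is_derive_eq; rewrite /GRing.scale/= /cosh; field. Qed.

Lemma cosh0 : cosh 0 = 1.
Proof. by rewrite /cosh oppr0 expR0; field. Qed.

Lemma coshN x : cosh (- x) = cosh x.
Proof. by rewrite /cosh opprK addrC. Qed.

Lemma sinh0 : sinh 0 = 0.
Proof. by rewrite /sinh oppr0 subrr mul0r. Qed.

Lemma sinh_ge0 x : 0 <= x -> 0 <= sinh x.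
Proof. by move=> x_ge0; rewrite divr_ge0// subr_ge0 ler_expR; lra. Qed.

Lemma is_derive_ge0_ndecr (f df : R -> R) (a x y : R) :
  (forall t : R, is_derive t (1 : R) f (df t)) ->
  (forall t, a < t -> 0 <= df t) ->
  a <= x -> x <= y -> f x <= f y.
Proof.
move=> f_df df_ge0; have f_derivable t : derivable f t 1 by case: (f_df t).
apply: ger0_derive1_ndecry => // [t|].
  by rewrite in_itv/= andbT derive1E derive_val; exact: df_ge0.
by apply: derivable_within_continuous => t _.
Qed.

Lemma sinh_le_mul_cosh x : 0 <= x -> sinh x <= x * cosh x.
Proof.
move=> x_ge0; rewrite -subr_ge0.
pose f (t : R) := t * cosh t - sinh t.
have -> : 0 = f 0 by rewrite /f sinh0 mul0r subr0.
apply: (@is_derive_ge0_ndecr f (fun t => t * sinh t) 0) => //.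
- by move=> t; apply: is_derive_eq; rewrite /GRing.scale/=; ring.
- by move=> t /ltW t_ge0; rewrite mulr_ge0 ?sinh_ge0.
Qed.

Lemma cosh_le_expR_sqr x : cosh x <= expR (x ^+ 2 / 2).
Proof.
wlog x_ge0 : x / 0 <= x.
  have [x_ge0|/ltW x_le0] := leP 0 x; first exact.
  by move/(_ (- x)); rewrite coshN sqrrN; apply; rewrite oppr_ge0.
pose f (t : R) := - (expR (- (t ^+ 2 / 2)) * cosh t).
have : f 0 <= f x.
  apply: (@is_derive_ge0_ndecr f
    (fun t => expR (- (t ^+ 2 / 2)) * (t * cosh t - sinh t)) 0) => //.
  - by move=> t; apply: is_derive_eq; rewrite /GRing.scale/=; field.
  - move=> t /ltW t_ge0.
    by rewrite mulr_ge0 ?expR_ge0// subr_ge0 sinh_le_mul_cosh.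
rewrite /f lerN2 expr0n/= mul0r oppr0 expR0 cosh0 mulr1.
by rewrite expRN ler_pdivrMl ?expR_gt0// mulr1.
Qed.

Lemma expR_le_chord x (h : R) : `|h| <= 1 ->
  expR (x * h) <= cosh x + h * sinh x.
Proof.
rewrite ler_norml => /andP[h_ge h_le].
have t_ge0 : 0 <= (1 + h) / 2 by lra.
have t_le1 : (1 + h) / 2 <= 1 by lra.
have -> : x * h = (1 + h) / 2 * x + (1 - (1 + h) / 2) * - x by field.
apply: le_trans (convex_expR (Itv01 t_ge0 t_le1) x (- x)) _.
by rewrite convRE /unstable.onem /cosh /sinh/=; lra.
Qed.

End HyperbolicFunctions.

Section LogSumExp.
Context {R : realType}.

Definition logsumexp (I : finType) (w : I -> R) : R := ln (\sum_i expR (w i)).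

Lemma sum_expR_ge0 (I : finType) (A : pred I) (w : I -> R) :
  0 <= \sum_(i | A i) expR (w i).
Proof. by apply: sumr_ge0 => i _; exact: expR_ge0. Qed.

Lemma sum_expR_gt0 (I : finType) (w : I -> R) : I -> 0 < \sum_i expR (w i).
Proof.
by move=> i; rewrite (bigD1 i)//= ltr_pwDl ?expR_gt0// sum_expR_ge0.
Qed.

Lemma le_logsumexp (I : finType) (w : I -> R) i : w i <= logsumexp w.
Proof.
rewrite -ler_expR lnK ?posrE ?sum_expR_gt0//.
by rewrite (bigD1 i)//= lerDl sum_expR_ge0.
Qed.

Lemma logsumexp_pair (I J : finType) (v : I -> R) (w : J -> R) : I -> J ->
  logsumexp (fun z => v z.1 + w z.2) = logsumexp v + logsumexp w.
Proof.
move=> i j; rewrite -lnM ?posrE ?sum_expR_gt0// mulr_suml; congr ln.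
rewrite -(pair_bigA _ (fun i j => expR (v i + w j)))/=; apply: eq_bigr => k _.
by rewrite mulr_sumr; apply: eq_bigr => l _; rewrite expRD.
Qed.

Lemma logsumexp_bool (t : R) :
  logsumexp (fun b : bool => b%:R * t) = ln (1 + expR t).
Proof. by rewrite /logsumexp big_bool mul1r mul0r expR0 addrC. Qed.

(* Hoeffding's lemma: [sum_i expR (w i) * h i] is, up to normalization, the mean
   of [h] under the Gibbs distribution of [w]. *)
Lemma logsumexp_tilt (I : finType) (w h : I -> R) (lam : R) : I -> 0 <= lam ->
  (forall i, `|h i| <= 1) -> \sum_i expR (w i) * h i <= 0 ->
  logsumexp (fun i => w i + lam * h i) <= logsumexp w + lam ^+ 2 / 2.
Proof.
move=> i lam_ge0 h_le1 mean_le0; have Z_gt0 v := @sum_expR_gt0 I v i.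
rewrite -[lam ^+ 2 / 2]expRK -lnM ?posrE ?expR_gt0//.
rewrite ler_ln ?posrE ?mulr_gt0 ?expR_gt0//.
apply: (@le_trans _ _ ((\sum_k expR (w k)) * cosh lam +
                       (\sum_k expR (w k) * h k) * sinh lam)).
  rewrite !mulr_suml -big_split/=; apply: ler_sum => k _.
  by rewrite expRD -mulrA -mulrDr ler_wpM2l ?expR_ge0// expR_le_chord.
rewrite -[leRHS]addr0 lerD ?mulr_le0_ge0 ?sinh_ge0//.
by rewrite ler_wpM2l ?(ltW (Z_gt0 _))// cosh_le_expR_sqr.
Qed.

End LogSumExp.

Section NonmaximalSum.
Context {R : realType}.
Implicit Type I : finType.

Lemma exists_argmax I (v : I -> R) : I -> exists i, forall j, v j <= v i.
Proof.
move=> i0; have [i _ v_le] := @arg_maxP _ R _ i0 xpredT v isT.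
by exists i => j; exact: v_le.
Qed.

Definition nonmax_sum I (v : I -> R) : R :=
  \sum_i expR (v i) - \big[Num.max/0]_i expR (v i).

Lemma nonmax_sumE I (v : I -> R) i : (forall j, v j <= v i) ->
  nonmax_sum v = \sum_j expR (v j) - expR (v i).
Proof.
move=> v_le; congr (_ - _); apply/eqP; rewrite eq_le le_bigmax// andbT.
by apply: bigmax_le => [|j _]; rewrite ?expR_ge0// ler_expR.
Qed.

Lemma nonmax_sum_gt0 I (v : I -> R) : (1 < #|I|)%N -> 0 < nonmax_sum v.
Proof.
move=> /card_gt1P[i [j [_ _ i_neq_j]]]; have [k v_le] := exists_argmax v i.
have [l l_neq_k] : exists l, l != k.
  by have [<-|] := eqVneq i k; [exists j; rewrite eq_sym|exists i].
rewrite (nonmax_sumE v_le) (bigD1 k)//= addrAC subrr add0r (bigD1 l)//=.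
by rewrite ltr_pwDl ?expR_gt0// sum_expR_ge0.
Qed.

End NonmaximalSum.

Section SurrogateAsLogLoss.
Context {R : realType} {K : nat}.
Hypothesis K_gt1 : (1 < K)%N.
Implicit Types (u : 'I_K.+1 -> R) (v : 'I_K -> R) (y m c : 'I_K).
Implicit Types (a f : option 'I_K) (z : 'I_K * bool) (lam : R).

Lemma nonmax_cls_gt0 u : 0 < nonmax_sum (u \o cls).
Proof. by rewrite nonmax_sum_gt0// card_ord. Qed.

Definition dfr_logit u : R := u dfr - ln (nonmax_sum (u \o cls)).

Lemma expR_dfr_logit u :
  expR (dfr_logit u) = expR (u dfr) / nonmax_sum (u \o cls).
Proof. by rewrite expRB lnK// posrE nonmax_cls_gt0. Qed.

Lemma psi_dfr_logistic u :
  psi_dfr u = expR (dfr_logit u) / (1 + expR (dfr_logit u)).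
Proof.
rewrite expR_dfr_logit /psi_dfr big_ord_recr/= addrAC.
rewrite -/(nonmax_sum (u \o cls)).
have := expR_gt0 (u dfr); have := nonmax_cls_gt0 u.
move: (expR _) (nonmax_sum _) => s D D_gt0 s_gt0.
by field; rewrite !gt_eqF//; lra.
Qed.

(* An outcome [(y, b)] is a label together with the truth value of [M = Y]; the
   surrogate is the log-loss of the Gibbs distribution of [outcome_logit]. *)
Definition outcome_logit u z : R := u (cls z.1) + z.2%:R * dfr_logit u.

Lemma ln_psi_cls u y :
  ln (psi_cls u y) = u (cls y) - logsumexp (u \o cls).
Proof.
by rewrite ln_div ?posrE ?expR_gt0 ?(sum_expR_gt0 (u \o cls) y)// expRK.
Qed.

Lemma ln_psi_dfr u :
  ln (psi_dfr u) = dfr_logit u - ln (1 + expR (dfr_logit u)).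
Proof.
by rewrite psi_dfr_logistic ln_div ?posrE ?addr_gt0 ?expR_gt0// expRK.
Qed.

Lemma ln_onem_psi_dfr u :
  ln (1 - psi_dfr u) = - ln (1 + expR (dfr_logit u)).
Proof.
have Z_gt0 : 0 < 1 + expR (dfr_logit u) by rewrite addr_gt0 ?expR_gt0.
rewrite psi_dfr_logistic -lnV ?posrE//; congr ln.
by field; rewrite gt_eqF.
Qed.

Lemma LpsiE u y m : Lpsi u y m =
  logsumexp (outcome_logit u) - outcome_logit u (y, m == y).
Proof.
rewrite (logsumexp_pair (u \o cls)
  (fun b : bool => b%:R * dfr_logit u) y true) logsumexp_bool.
rewrite /Lpsi ln_psi_cls ln_psi_dfr ln_onem_psi_dfr.
by case: (m == y); rewrite /outcome_logit/=; ring.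
Qed.

Lemma Lpsi_ge0 u y m : 0 <= Lpsi u y m.
Proof. by rewrite LpsiE subr_ge0 le_logsumexp. Qed.

Definition correct a z : bool := if a is Some c then c == z.1 else z.2.

Lemma loss01_deferE a y m :
  loss01_defer a y m = 1 - (correct a (y, m == y))%:R :> R.
Proof.
by case: a => [c|] /=; case: (_ == y); rewrite ?subrr ?subr0.
Qed.

Lemma correctE a z :
  (correct a z)%:R = (a == Some z.1)%:R + z.2%:R * (a == None)%:R :> R.
Proof.
by case: a => [c|]; rewrite /= ?mulr0 ?addr0 ?mulr1 ?add0r.
Qed.

Definition correct_mass u a : R :=
  \sum_z expR (outcome_logit u z) * (correct a z)%:R.

Lemma correct_massE u a : correct_mass u a =
  \sum_y expR (u (cls y)) * (expR (dfr_logit u) * (correct a (y, true))%:R +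
                             (correct a (y, false))%:R).
Proof.
rewrite /correct_mass -(pair_bigA _ (fun y b =>
  expR (outcome_logit u (y, b)) * (correct a (y, b))%:R))/=.
apply: eq_bigr => y _.
by rewrite big_bool /outcome_logit/= mul1r mul0r addr0 expRD; ring.
Qed.

Lemma correct_mass_Some u c :
  correct_mass u (Some c) = expR (u (cls c)) * (1 + expR (dfr_logit u)).
Proof.
rewrite correct_massE (bigD1 c)//= big1 => [|y y_neq_c].
  by rewrite eqxx addr0 mulr1 addrC.
by rewrite eq_sym (negbTE y_neq_c) mulr0 addr0 mulr0.
Qed.

Lemma correct_mass_None u :
  correct_mass u None = (\sum_y expR (u (cls y))) * expR (dfr_logit u).
Proof.
rewrite correct_massE mulr_suml; apply: eq_bigr => y _.
by rewrite mulr1 addr0.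
Qed.

(* This cancellation, due to the maximum subtracted in [psi_dfr], is why
   comparing [u dfr] with the largest class score is optimal. *)
Lemma correct_mass_gap u c : (forall y, u (cls y) <= u (cls c)) ->
  correct_mass u None - correct_mass u (Some c) =
  expR (u dfr) - expR (u (cls c)).
Proof.
move=> u_le; rewrite correct_mass_None correct_mass_Some expR_dfr_logit.
have := nonmax_cls_gt0 u; rewrite (nonmax_sumE u_le)/= => nonmax_gt0.
by field; rewrite gt_eqF.
Qed.

Lemma argmax_clsP u :
  exists2 c, argmax_cls u = Some c & forall y, u (cls y) <= u (cls c).
Proof.
rewrite /argmax_cls; case: pickP => [c /forallP u_le|no_max]; first by exists c.
have [c u_le] := exists_argmax (u \o cls) (Ordinal (ltnW K_gt1)).
by move: (no_max c) => /negP[]; apply/forallP.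
Qed.

Lemma phiE u : phi u =
  if [forall y, u (cls y) < u dfr] then None else argmax_cls u.
Proof.
rewrite /phi; congr (if _ then _ else _); apply/idP/forallP => [max_lt y|u_lt].
  by rewrite -lte_fin; apply: le_lt_trans max_lt; exact: le_bigmax.
by apply/bigmax_ltP; split => [|y _]; rewrite ?ltNyr// lte_fin.
Qed.

Lemma correct_mass_argmax u y :
  correct_mass u (Some y) <= correct_mass u (argmax_cls u).
Proof.
have [c -> u_le] := argmax_clsP u.
by rewrite !correct_mass_Some ler_wpM2r ?addr_ge0 ?expR_ge0// ler_expR.
Qed.

Lemma correct_mass_phi u f : correct_mass u f <= correct_mass u (phi u).
Proof.
have [c argmax_u u_le] := argmax_clsP u; have gap := correct_mass_gap u_le.
have class_le y : correct_mass u (Some y) <= correct_mass u (Some c).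
  by rewrite -argmax_u correct_mass_argmax.
rewrite phiE argmax_u; case: ifPn => [/forallP dfr_gt|].
- case: f => [y|//]; apply: le_trans (class_le y) _.
  by rewrite -subr_ge0 gap subr_ge0 ler_expR ltW.
- rewrite negb_forall => /existsP[y]; rewrite -leNgt => dfr_le.
  case: f => [//|]; rewrite -subr_le0 gap subr_le0 ler_expR.
  exact: le_trans (u_le y).
Qed.

Definition scores_of v (t : R) (i : 'I_K.+1) : R :=
  if unlift ord_max i is Some y then v y else t + ln (nonmax_sum v).

Lemma scores_of_cls v t y : scores_of v t (cls y) = v y.
Proof.
have -> : cls y = lift ord_max y by apply: ord_inj; rewrite lift_max.
by rewrite /scores_of liftK.
Qed.

Lemma dfr_logit_scores_of v t : dfr_logit (scores_of v t) = t.
Proof.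
rewrite /dfr_logit; have -> : scores_of v t \o cls = v.
  by apply/funext => y; exact: scores_of_cls.
by rewrite /scores_of /dfr unlift_none addrK.
Qed.

Definition tilt lam f a u : 'I_K.+1 -> R :=
  scores_of (fun y => u (cls y) + lam * ((f == Some y)%:R - (a == Some y)%:R))
            (dfr_logit u + lam * ((f == None)%:R - (a == None)%:R)).

Lemma outcome_logit_tilt lam f a u z :
  outcome_logit (tilt lam f a u) z =
  outcome_logit u z + lam * ((correct f z)%:R - (correct a z)%:R).
Proof.
rewrite /outcome_logit /tilt scores_of_cls dfr_logit_scores_of !correctE; ring.
Qed.

Lemma Lpsi_tilt lam f a u y m :
  0 <= lam -> correct_mass u f <= correct_mass u a ->
  Lpsi (tilt lam f a u) y m + lam * loss01_defer a y m <=
  Lpsi u y m + lam * loss01_defer f y m + lam ^+ 2 / 2.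
Proof.
move=> lam_ge0 f_le_a; rewrite !LpsiE !loss01_deferE outcome_logit_tilt.
pose gain z : R := (correct f z)%:R - (correct a z)%:R.
have gain_le1 z : `|gain z| <= 1.
  by rewrite /gain; case: correct; case: correct;
    rewrite ?subrr ?subr0 ?sub0r ?normrN ?normr0 ?normr1.
have mean_gain : \sum_z expR (outcome_logit u z) * gain z <= 0.
  by under eq_bigr do rewrite mulrBr; rewrite sumrB subr_le0.
have -> : outcome_logit (tilt lam f a u) =
    fun z => outcome_logit u z + lam * gain z.
  by apply/funext => z; exact: outcome_logit_tilt.
have := logsumexp_tilt (y, true) lam_ge0 gain_le1 mean_gain; lra.
Qed.

End SurrogateAsLogLoss.

Section FiniteValuedMaps.
Context {d : measure_display} {T : measurableType d}.
Implicit Types I J : finType.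

Lemma measurable_finmap_preimage I (s : T -> I) (A : set I) :
  measurable_finmap s -> measurable (s @^-1` A).
Proof.
move=> ms; rewrite -[A]image_id -bigcup_imset1 preimage_bigcup.
by apply: fin_bigcup_measurable => [|i _]; [exact: finite_finset|exact: ms].
Qed.

Lemma measurable_finmap_postcomp I J (h : I -> J) (s : T -> I) :
  measurable_finmap s -> measurable_finmap (h \o s).
Proof.
by move=> ms j; rewrite comp_preimage; exact: measurable_finmap_preimage.
Qed.

Lemma measurable_finmap_precomp {d' : measure_display} {U : measurableType d'}
    I (s : T -> I) (X : U -> T) :
  measurable_fun setT X -> measurable_finmap s -> measurable_finmap (s \o X).
Proof.
move=> mX ms i; rewrite -[Z in measurable Z]setTI.
exact: (mX measurableT _ (ms i)).
Qed.

Lemma measurable_finmap_pair I J (s : T -> I) (t : T -> J) :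
  measurable_finmap s -> measurable_finmap t ->
  measurable_finmap (fun x => (s x, t x)).
Proof.
move=> ms mt [i j].
rewrite (_ : _ @^-1` _ = s @^-1` [set i] `&` t @^-1` [set j]).
  exact: measurableI.
by apply/seteqP; split => x /= [-> ->].
Qed.

Lemma measurable_finmap_ffun I J (s : I -> T -> J) :
  (forall i, measurable_finmap (s i)) ->
  measurable_finmap (fun x => [ffun i => s i x]).
Proof.
move=> ms t.
rewrite (_ : _ @^-1` _ = \bigcap_(i in [set: I]) s i @^-1` [set t i]).
  by apply: fin_bigcap_measurable => [|i _]; [exact: finite_finset|exact: ms].
apply/seteqP; split => [x /= <- i _|x s_eq_t]; first by rewrite /= ffunE.
by apply/ffunP => i; rewrite ffunE; exact: s_eq_t.
Qed.

Lemma measurable_fun_finmap {d' : measure_display} {U : measurableType d'}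
    I (s : T -> I) (F : I -> T -> U) :
  measurable_finmap s -> (forall i, measurable_fun setT (F i)) ->
  measurable_fun setT (fun x => F (s x) x).
Proof.
move=> ms mF _ B mB; rewrite setTI.
have -> : (fun x => F (s x) x) @^-1` B =
    \bigcup_(i in [set: I]) (s @^-1` [set i] `&` F i @^-1` B).
  by apply/seteqP; split => [x Bx|x [i _ [<-]]//]; exists (s x).
apply: fin_bigcup_measurable => [|i _]; first exact: finite_finset.
by apply: measurableI; [exact: ms|rewrite -[X in measurable X]setTI; exact: mF].
Qed.

End FiniteValuedMaps.

Section RealFunctionsMeasurability.
Context {R : realType} {d : measure_display} {T : measurableType d}.

Lemma measurable_logsumexp (I : finType) (w : I -> T -> R) :
  (forall i, measurable_fun setT (w i)) ->
  measurable_fun setT (fun x => logsumexp (w^~ x)).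
Proof.
move=> mw; apply: measurableT_comp (@measurable_ln R) _.
by apply: measurable_sum => i; exact: measurableT_comp (@measurable_expR R) _.
Qed.

Lemma measurable_bigmaxr (I : Type) (s : seq I) (x0 : R) (h : I -> T -> R) :
  (forall i, measurable_fun setT (h i)) ->
  measurable_fun setT (fun x => \big[Num.max/x0]_(i <- s) h i x).
Proof.
move=> mh; elim: s => [|i s IHs].
  by under eq_fun do rewrite big_nil; exact: measurable_cst.
by under eq_fun do rewrite big_cons; exact: measurable_maxr.
Qed.

Lemma measurable_nonmax_sum (I : finType) (v : I -> T -> R) :
  (forall i, measurable_fun setT (v i)) ->
  measurable_fun setT (fun x => nonmax_sum (v^~ x)).
Proof.
move=> mv; have mexp i : measurable_fun setT (fun x => expR (v i x)).
  exact: measurableT_comp (@measurable_expR R) _.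
by apply: measurable_funB; [exact: measurable_sum|exact: measurable_bigmaxr].
Qed.

Definition comparisons (I : finType) (g : I -> T -> R) (x : T) :
  {ffun I * I -> bool} := [ffun p => g p.1 x <= g p.2 x].

Lemma measurable_comparisons (I : finType) (g : I -> T -> R) :
  (forall i, measurable_fun setT (g i)) -> measurable_finmap (comparisons g).
Proof.
move=> mg; apply: measurable_finmap_ffun => p b.
by rewrite -[X in measurable X]setTI; exact: measurable_fun_ler.
Qed.

End RealFunctionsMeasurability.

Section ScorerMeasurability.
Context {R : realType} {K : nat} {d : measure_display} {T : measurableType d}.
Implicit Types (g : 'I_K.+1 -> T -> R) (v : 'I_K -> T -> R).

Definition argmax_of_comparisons (r : {ffun 'I_K.+1 * 'I_K.+1 -> bool}) :
  option 'I_K := [pick i : 'I_K | [forall j : 'I_K, r (cls j, cls i)]].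

Lemma argmax_clsE g x :
  argmax_cls (g^~ x) = argmax_of_comparisons (comparisons g x).
Proof. by apply: eq_pick => i; apply: eq_forallb => j; rewrite ffunE. Qed.

Lemma measurable_argmax_cls g : measurable_scorer g ->
  measurable_finmap (fun x => argmax_cls (g^~ x)).
Proof.
move=> mg; rewrite (funext (argmax_clsE g)).
exact/(measurable_finmap_postcomp argmax_of_comparisons)/measurable_comparisons.
Qed.

Lemma measurable_phi g : measurable_scorer g ->
  measurable_finmap (fun x => phi (g^~ x)).
Proof.
move=> mg; pose phi_of_comparisons (r : {ffun 'I_K.+1 * 'I_K.+1 -> bool}) :=
  if [forall y : 'I_K, ~~ r (dfr, cls y)] then None
  else argmax_of_comparisons r.
have -> : (fun x => phi (g^~ x)) = phi_of_comparisons \o comparisons g.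
  apply/funext => x; rewrite phiE argmax_clsE; congr (if _ then _ else _).
  by apply: eq_forallb => y; rewrite ffunE/= ltNge.
exact/measurable_finmap_postcomp/measurable_comparisons.
Qed.

Lemma measurable_dfr_logit g : measurable_scorer g ->
  measurable_fun setT (fun x => dfr_logit (g^~ x)).
Proof.
move=> mg; apply: measurable_funB => //.
apply: measurableT_comp (@measurable_ln R) _.
exact: (measurable_nonmax_sum (v := fun y => g (cls y))).
Qed.

Lemma measurable_outcome_logit g z : measurable_scorer g ->
  measurable_fun setT (fun x => outcome_logit (g^~ x) z).
Proof.
move=> mg; apply: measurable_funD => //.
by apply: measurable_funM => //; exact: measurable_dfr_logit.
Qed.

Lemma measurable_Lpsi g (y m : 'I_K) : (1 < K)%N -> measurable_scorer g ->
  measurable_fun setT (fun x => Lpsi (g^~ x) y m).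
Proof.
move=> K_gt1 mg; under eq_fun do rewrite LpsiE//.
apply: measurable_funB; last exact: measurable_outcome_logit.
apply: (measurable_logsumexp (w := fun z x => outcome_logit (g^~ x) z)) => z.
exact: measurable_outcome_logit.
Qed.

Lemma measurable_scores_of v (t : T -> R) :
  (forall y, measurable_fun setT (v y)) -> measurable_fun setT t ->
  measurable_scorer (fun i x => scores_of (v^~ x) (t x) i).
Proof.
move=> mv mt i; rewrite /scores_of; case: (unlift _ _) => [y|]; first exact: mv.
apply: measurable_funD => //; apply: measurableT_comp (@measurable_ln R) _.
exact: measurable_nonmax_sum.
Qed.

Lemma measurable_tilt (lam : R) (f a : T -> option 'I_K) g :
  measurable_finmap f -> measurable_finmap a -> measurable_scorer g ->
  measurable_scorer (fun i x => tilt lam (f x) (a x) (g^~ x) i).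
Proof.
move=> mf ma mg i.
apply: (measurable_fun_finmap (s := fun x => (f x, a x))
  (F := fun p x => tilt lam p.1 p.2 (g^~ x) i)) => [|[b c]].
  exact: measurable_finmap_pair.
apply: (measurable_scores_of
  (v := fun y x => g (cls y) x + lam * ((b == Some y)%:R - (c == Some y)%:R))).
- by move=> y; exact: measurable_funD.
- by apply: measurable_funD => //; exact: measurable_dfr_logit.
Qed.

End ScorerMeasurability.

Section IntegralsOfRealFunctions.
Local Open Scope ereal_scope.
Context {R : realType} {d : measure_display} {T : measurableType d}.

Lemma ge0_integralDZl_EFin (mu : {measure set T -> \bar R})
    (F G : T -> R) (k : R) :
  measurable_fun setT F -> measurable_fun setT G ->
  (forall x, 0 <= F x)%R -> (forall x, 0 <= G x)%R -> (0 <= k)%R ->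
  \int[mu]_x (F x + k * G x)%:E =
  \int[mu]_x (F x)%:E + k%:E * \int[mu]_x (G x)%:E.
Proof.
move=> /measurable_EFinP mF /measurable_EFinP mG F_ge0 G_ge0 k_ge0.
rewrite -ge0_integralZl_EFin//; last by move=> x _; rewrite lee_fin.
rewrite -ge0_integralD//.
- by move=> x _; rewrite lee_fin.
- by move=> x _; rewrite mule_ge0 ?lee_fin.
- exact: measurable_funeM.
Qed.

Lemma ge0_integralD_cst (P : probability T R) (F : T -> R) (k : R) :
  measurable_fun setT F -> (forall x, 0 <= F x)%R -> (0 <= k)%R ->
  \int[P]_x (F x + k)%:E = \int[P]_x (F x)%:E + k%:E.
Proof.
move=> /measurable_EFinP mF F_ge0 k_ge0.
rewrite -[in RHS](mule1 k%:E) -[X in _ * X](probability_setT P) -integral_cst//.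
by rewrite -ge0_integralD// => x _; rewrite lee_fin.
Qed.

Lemma integral_finmap_fin_num (mu : {finite_measure set T -> \bar R})
    (I : finType) (s : T -> I) (F : I -> R) : measurable_finmap s ->
  \int[mu]_x (F (s x))%:E \is a fin_num.
Proof.
move=> ms; apply: integrable_fin_num => //.
apply: (measurable_bounded_integrable (f := F \o s)) => //.
- by rewrite ltey_eq fin_num_measure.
- exact: (measurable_fun_finmap (F := fun i _ => F i)).
- exists (\sum_i `|F i|)%R; split => [|M sum_lt x _].
    by rewrite ger0_real// sumr_ge0.
  apply: ltW (le_lt_trans _ sum_lt).
  by rewrite (bigD1 (s x))//= lerDl sumr_ge0.
Qed.

Lemma leeB_ereal_inf (A : set (\bar R)) (x b : \bar R) :
  x \is a fin_num -> 0 <= b -> (forall y, A y -> x - y <= b) ->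
  x - ereal_inf A <= b.
Proof.
move=> x_fin; case: b => [b| |//] _ xB_le; last exact: leey.
rewrite lee_subel_addl// addeC -leeBlDl//; apply: le_ereal_inf_tmp => y Ay.
by rewrite leeBlDl// addeC -lee_subel_addl//; exact: xB_le.
Qed.

(* [lam := D] minimizes [lam ^+ 2 / 2 - lam * D]. *)
Lemma le_sqrte_parabola (D S : R) (L : \bar R) :
  (forall lam : R, (0 <= lam)%R -> (S + lam * D)%:E <= L + (lam ^+ 2 / 2)%:E) ->
  D%:E <= sqrte (2%:E * (L - S%:E)).
Proof.
have [D_ge0 /(_ D D_ge0)|/ltW D_le0 _] := leP 0%R D; last first.
  by apply: le_trans (sqrte_ge0 _); rewrite lee_fin.
case: L => [L||] //=; last first.
  by move=> _; rewrite addye// mulry gtr0_sg// mul1e leey.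
rewrite -EFinD !lee_fin => parabola_at_D.
rewrite -[leLHS]ger0_norm// -sqrtr_sqr ler_wsqrtr//; nra.
Qed.

End IntegralsOfRealFunctions.

Section Regret.
Local Open Scope ereal_scope.
Context {R : realType} {K : nat}.
Hypothesis K_gt1 : (1 < K)%N.
Context {d : measure_display} {Omega : measurableType d}.
Variable P : probability Omega R.
Context {dX : measure_display} {Xs : measurableType dX}.
Variables (X : Omega -> Xs) (Y M : Omega -> 'I_K).
Hypotheses (mX : measurable_fun setT X) (mY : measurable_finmap Y).
Hypothesis mM : measurable_finmap M.
Implicit Types (g : 'I_K.+1 -> Xs -> R) (a f : Xs -> option 'I_K).

Local Notation surrogate g := (fun w => Lpsi (g^~ (X w)) (Y w) (M w)).
Local Notation defer_loss a :=
  (fun w => loss01_defer (a (X w)) (Y w) (M w) : R).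

Lemma measurable_surrogate g :
  measurable_scorer g -> measurable_fun setT (surrogate g).
Proof.
move=> mg; apply: (measurable_fun_finmap (s := fun w => (Y w, M w))
  (F := fun ym w => Lpsi (g^~ (X w)) ym.1 ym.2)) => [|ym].
  exact: measurable_finmap_pair.
apply: (measurable_Lpsi (g := fun i => g i \o X)) => // i.
exact: measurableT_comp (mg i) mX.
Qed.

Lemma measurable_finmap_decision a : measurable_finmap a ->
  measurable_finmap (fun w => (a (X w), (Y w, M w))).
Proof.
move=> ma; apply: measurable_finmap_pair; last exact: measurable_finmap_pair.
exact: (measurable_finmap_precomp mX ma).
Qed.

Lemma measurable_defer_loss a :
  measurable_finmap a -> measurable_fun setT (defer_loss a).
Proof.
move/measurable_finmap_decision => ma.
by apply: (measurable_fun_finmap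
  (F := fun s _ => loss01_defer s.1 s.2.1 s.2.2) ma).
Qed.

Lemma loss01_defer_ge0 (b : option 'I_K) y m :
  (0 <= loss01_defer b y m :> R)%R.
Proof. by case: b => [c|]; exact: ler0n. Qed.

Lemma risk01_defer_of_fin_num a : measurable_finmap a ->
  risk01_defer_of P X Y M a \is a fin_num.
Proof.
move/measurable_finmap_decision.
exact: (integral_finmap_fin_num _ (fun s => loss01_defer s.1 s.2.1 s.2.2)).
Qed.

Lemma risk_L_star_le g : measurable_scorer g ->
  risk_L_star P X Y M <= risk_L P X Y M g.
Proof. by move=> mg; apply: ereal_inf_lbound; exists g. Qed.

Lemma risk_L_star_fin_num : risk_L_star P X Y M \is a fin_num.
Proof.
have star_ge0 : 0 <= risk_L_star P X Y M.
  apply: le_ereal_inf_tmp => _ [g _ <-].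
  by apply: integral_ge0 => w _; rewrite lee_fin Lpsi_ge0.
have mzero : measurable_scorer (fun (_ : 'I_K.+1) (_ : Xs) => 0%R : R).
  by move=> i; exact: measurable_cst.
have zero_fin_num : risk_L P X Y M (fun _ _ => 0%R) \is a fin_num.
  exact: (integral_finmap_fin_num _ (fun ym => Lpsi (fun=> 0%R) ym.1 ym.2)
    (measurable_finmap_pair mY mM)).
rewrite ge0_fin_numE//; apply: le_lt_trans (risk_L_star_le mzero) _.
by rewrite ltey_eq zero_fin_num.
Qed.

Lemma risk_LD_risk01_defer (lam : R) g a : (0 <= lam)%R ->
  measurable_scorer g -> measurable_finmap a ->
  risk_L P X Y M g + lam%:E * risk01_defer_of P X Y M a =
  \int[P]_w (surrogate g w + lam * defer_loss a w)%:E.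
Proof.
move=> lam_ge0 mg ma; rewrite ge0_integralDZl_EFin//.
- exact: measurable_surrogate.
- exact: measurable_defer_loss.
- by move=> w; exact: Lpsi_ge0.
- by move=> w; exact: loss01_defer_ge0.
Qed.

Lemma risk_L_star_tilt (lam : R) g a f : (0 <= lam)%R ->
  measurable_scorer g -> measurable_finmap a -> measurable_finmap f ->
  (forall x, correct_mass (g^~ x) (f x) <= correct_mass (g^~ x) (a x))%R ->
  risk_L_star P X Y M + lam%:E * risk01_defer_of P X Y M a <=
  risk_L P X Y M g + lam%:E * risk01_defer_of P X Y M f + (lam ^+ 2 / 2)%:E.
Proof.
move=> lam_ge0 mg ma mf f_le_a.
pose g' i x := tilt lam (f x) (a x) (g^~ x) i.
have mg' : measurable_scorer g' by exact: measurable_tilt.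
have sum_ge0 h b w : (0 <= surrogate h w + lam * defer_loss b w)%R.
  by rewrite addr_ge0 ?Lpsi_ge0 ?mulr_ge0 ?loss01_defer_ge0.
have msum h b : measurable_scorer h -> measurable_finmap b ->
    measurable_fun setT (fun w => surrogate h w + lam * defer_loss b w)%R.
  move=> mh mb; apply: measurable_funD; first exact: measurable_surrogate.
  by apply: measurable_funM => //; exact: measurable_defer_loss.
apply: le_trans (leeD2r _ (risk_L_star_le mg')) _.
rewrite [leLHS]risk_LD_risk01_defer//.
rewrite [X in X + (_ / _)%:E]risk_LD_risk01_defer//.
rewrite -ge0_integralD_cst ?divr_ge0 ?sqr_ge0//; last exact: msum.
apply: ge0_le_integral => //.
- by move=> w _; rewrite lee_fin sum_ge0.
- by apply/measurable_EFinP; exact: msum.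
- by apply/measurable_EFinP; apply: measurable_funD => //; exact: msum.
- by move=> w _; rewrite lee_fin; exact: Lpsi_tilt.
Qed.

Lemma regret_le_sqrt_excess g a f :
  measurable_scorer g -> measurable_finmap a -> measurable_finmap f ->
  (forall x, correct_mass (g^~ x) (f x) <= correct_mass (g^~ x) (a x))%R ->
  risk01_defer_of P X Y M a - risk01_defer_of P X Y M f <=
  sqrte (2%:E * (risk_L P X Y M g - risk_L_star P X Y M)).
Proof.
move=> mg ma mf f_le_a.
have tilt_le lam lam_ge0 := @risk_L_star_tilt lam g a f lam_ge0 mg ma mf f_le_a.
move: risk_L_star_fin_num (risk01_defer_of_fin_num ma)
  (risk01_defer_of_fin_num mf) tilt_le.
move=> /fineK <- /fineK <- /fineK <- tilt_le.
rewrite -EFinB; apply: le_sqrte_parabola => lam /tilt_le.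
rewrite -!EFinM -EFinD; case: (risk_L _ _ _ _ _) => [L| |]//;
  last by rewrite !addye ?leey.
rewrite -!EFinD !lee_fin; lra.
Qed.

Lemma regret_inf_le_sqrt_excess g a (C : set (Xs -> option 'I_K)) :
  measurable_scorer g -> measurable_finmap a ->
  C `<=` @measurable_finmap _ _ _ ->
  (forall f, C f ->
    forall x, (correct_mass (g^~ x) (f x) <= correct_mass (g^~ x) (a x))%R) ->
  risk01_defer_of P X Y M a -
    ereal_inf [set risk01_defer_of P X Y M f | f in C] <=
  sqrte (2%:E * (risk_L P X Y M g - risk_L_star P X Y M)).
Proof.
move=> mg ma mC f_le_a; apply: leeB_ereal_inf; rewrite ?sqrte_ge0//.
  exact: risk01_defer_of_fin_num.
move=> _ [f Cf <-].
by apply: regret_le_sqrt_excess => //; [exact: mC|exact: f_le_a].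
Qed.

Lemma risk01_defer_of_total a :
  measurable_finmap a -> (forall x, a x != None) ->
  P [set w | a (X w) != Some (Y w)] = risk01_defer_of P X Y M a.
Proof.
move=> ma a_total; set A := [set w | _].
have mA : measurable A.
  exact: (measurable_finmap_preimage [set s | s.1 != Some s.2.1]
    (measurable_finmap_decision ma)).
rewrite -[A in LHS]setIT -integral_indic//; apply: eq_integral => w _.
rewrite indicE; congr (_%:E); rewrite /loss01_defer.
case aE : (a (X w)) (a_total (X w)) => [c|]//= _.
by congr ((nat_of_bool _)%:R); apply/idP/idP; rewrite inE /A/= aE.
Qed.

Lemma risk01_as_defer g : measurable_scorer g ->
  risk01 P X Y g = risk01_defer_of P X Y M (fun x => argmax_cls (g^~ x)).
Proof.
move=> mg; apply: risk01_defer_of_total => [|x].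
  exact: measurable_argmax_cls.
by have [c ->] := argmax_clsP K_gt1 (g^~ x).
Qed.

Lemma risk01_star_as_defer : risk01_star P X Y =
  ereal_inf [set risk01_defer_of P X Y M f |
             f in [set Some \o h | h in @measurable_finmap _ Xs 'I_K]].
Proof.
rewrite image_comp; congr ereal_inf; apply: eq_imagel => h mh /=.
by rewrite -risk01_defer_of_total//; exact: measurable_finmap_postcomp.
Qed.

End Regret.

Local Open Scope ereal_scope.

Theorem theorem3 (R : realType) (K : nat) (hK : (1 < K)%N)
  (d : measure_display) (Omega : measurableType d) (P : probability Omega R)
  (dX : measure_display) (Xs : measurableType dX)
  (X : Omega -> Xs) (Y M : Omega -> 'I_K)
  (mX : measurable_fun setT X)
  (mY : forall k : 'I_K, measurable (Y @^-1` [set k]))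
  (mM : forall k : 'I_K, measurable (M @^-1` [set k]))
  (g : 'I_K.+1 -> Xs -> R) (mg : measurable_scorer g) :
  maxe (risk01 P X Y g - risk01_star P X Y)
       (risk01_defer P X Y M g - risk01_defer_star P X Y M)
  <= sqrte (2%:E * (risk_L P X Y M g - risk_L_star P X Y M)).
Proof.
rewrite ge_max; apply/andP; split.
- rewrite (risk01_as_defer hK P mX mY mM mg) (risk01_star_as_defer P mX mY mM).
  apply: regret_inf_le_sqrt_excess => //; first exact: measurable_argmax_cls.
  + by move=> _ [h mh <-]; exact: measurable_finmap_postcomp.
  + by move=> _ [h _ <-] x; exact: correct_mass_argmax.
- apply: regret_inf_le_sqrt_excess => //; first exact: measurable_phi.
  by move=> f _ x; exact: correct_mass_phi.
Qed.
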